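(* Let $M$ be a finitely generated multiplication $R$-module and let $S$ be a multiplicatively closed subset of $R$. Let $N,N_{1},N_{2},\dots,N_{n}$ be submodules of $M$ such that $N\subseteq N_{1}\cup N_{2}\cup\dots\cup N_{n}$, where at most two of $N_{1},N_{2},\dots,N_{n}$ are not $S$-$1$-absorbing primary submodules. Suppose that $\sqrt{(N_{k}:m)}\cap S=\emptyset$ for all $1\leq k\leq n$ and all $m\in M\setminus N_{k}$. If $\sqrt{(N_{j}:M)}\nsubseteq(\sqrt{(N_{k}:m)}:s)$ for all $s\in S$ and all $m\in M\setminus N_k$ whenever $j\neq k$, then $N\subseteq N_{k}$ for some $k$.
   Context: All rings are commutative with non-zero identity and all modules are unital. An $R$-module $M$ is a multiplication module if every submodule of $M$ has the form $IM$ for some ideal $I$ of $R$. For a submodule $N$ of $M$ and $m\in M$, $(N:M)=(N:_{R}M)=\{r\in R\mid rM\subseteq N\}$ and $(N:m)=\{r\in R\mid rm\in N\}$; for an ideal $I$ of $R$ and $s\in R$, $(I:s)=\{r\in R\mid rs\in I\}$, and $\sqrt{I}$ is the radical of $I$. A prime submodule of $M$ is a proper submodule $P$ such that $rm\in P$ ($r\in R$, $m\in M$) implies $r\in(P:_RM)$ or $m\in P$. $M\text{-}rad(N)$ is the intersection of all prime submodules of $M$ containing $N$ (it equals $M$ if there are none). A submodule $N$ of $M$ with $(N:_{R}M)\cap S=\emptyset$ is called $S$-$1$-absorbing primary if there exists a fixed $s\in S$ such that for all non-unit $a,b\in R$ and all $m\in M$, if $abm\in N$, then $sab\in(N:_{R}M)$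 or $sm\in M\text{-}rad(N)$. *)

(* Defs.v *)
From mathcomp Require Import all_boot all_order all_algebra.
From mathcomp Require Import boolp classical_sets cardinality.

Set Implicit Arguments.
Unset Strict Implicit.
Unset Printing Implicit Defensive.

Import GRing.Theory.
Local Open Scope classical_set_scope.
Local Open Scope ring_scope.

Definition is_submodule (R : comNzRingType) (M : lmodType R) (N : set M) : Prop :=
  GRing.submod_closed [in N].

(* The library's [idealr_closed] also requires properness, hence the detour
   through submodules of the regular module. *)
Definition is_ideal (R : comNzRingType) (I : set R) : Prop :=
  is_submodule (I : set R^o).

Definition mult_closed (R : comNzRingType) (S : set R) : Prop :=
  GRing.mulr_closed [in S].

(* A [comNzRingType] carries no [GRing.unit] predicate. *)
Definition is_unit (R : comNzRingType) (a : R) : Prop := exists b : R, a * b = 1.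

Definition ideal_smul (R : comNzRingType) (M : lmodType R) (I : set R) : set M :=
  [set x | exists (n : nat) (a : 'I_n -> R) (m : 'I_n -> M),
     (forall i, I (a i)) /\ x = \sum_(i < n) a i *: m i].

Definition multiplication_module (R : comNzRingType) (M : lmodType R) : Prop :=
  forall N : set M, is_submodule N ->
    exists I : set R, is_ideal I /\ N = ideal_smul I.

Definition finitely_generated (R : comNzRingType) (M : lmodType R) : Prop :=
  exists (n : nat) (g : 'I_n -> M),
    forall x : M, exists c : 'I_n -> R, x = \sum_(i < n) c i *: g i.

(* (N : M) *)
Definition colon_module (R : comNzRingType) (M : lmodType R) (N : set M) : set R :=
  [set r | forall m : M, N (r *: m)].

(* (N : m) *)
Definition colon_elt (R : comNzRingType) (M : lmodType R) (N : set M) (m : M) :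
    set R :=
  [set r | N (r *: m)].

(* (I : s) *)
Definition colon_ideal (R : comNzRingType) (I : set R) (s : R) : set R :=
  [set r | I (r * s)].

Definition radical (R : comNzRingType) (I : set R) : set R :=
  [set r | exists2 k : nat, (0 < k)%N & I (r ^+ k)].

Definition prime_submodule (R : comNzRingType) (M : lmodType R) (P : set M) : Prop :=
  [/\ is_submodule P, P <> setT &
      forall (r : R) (m : M), P (r *: m) -> colon_module P r \/ P m].

(* The intersection over the empty family is [setT], i.e. all of M. *)
Definition module_radical (R : comNzRingType) (M : lmodType R) (N : set M) : set M :=
  \bigcap_(P in [set P : set M | prime_submodule P /\ N `<=` P]) P.

Definition S_1_absorbing_primary (R : comNzRingType) (M : lmodType R)
    (S : set R) (N : set M) : Prop :=
  [/\ is_submodule N, colon_module N `&` S = set0 &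
      exists2 s : R, S s &
        forall (a b : R) (m : M), ~ is_unit a -> ~ is_unit b ->
          N ((a * b) *: m) ->
          colon_module N (s * a * b) \/ module_radical N (s *: m)].

(* Main.v *)
Require Import Defs.
From mathcomp Require Import all_boot all_order all_algebra.
From mathcomp Require Import boolp classical_sets cardinality.

Import GRing.Theory.
Local Open Scope classical_set_scope.
Local Open Scope ring_scope.

(** The argument is prime avoidance.  Shrink the family to an irredundant
    subcover of N.  If it has a single member, that member contains N; it cannot
    have exactly two, since no group is an irredundant union of two subgroups.
    Otherwise it has at least three members, so one of them, K, is
    S-1-absorbing primary, and some m in N lies outside K.  In an irredundant
    cover, an element of N lying in all the other members lies in K as well
    ([mem_minimal_cover]).  Since 1 is in S, each other member N_j yields an
    r_j with r_j M inside N_j and r_j outside the radical of (K : m).  The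
    product r of the r_j sends m into all the other members, hence into K, so
    r is in (K : m).  This is absurd once the radical of (K : m) is known to be
    a prime ideal.

    That primality ([radical_colon_elt_prime]) is the heart of the proof.  The
    disjointness of S from the radicals of the (K : x) says that elements of S
    can be cancelled modulo K, so the factor s of the definition disappears.
    In a finitely generated module, r M inside M-rad(K) forces r into
    p = sqrt(K : M) ([colon_module_radical]), because any r outside p is
    avoided by a prime submodule above K, given by Zorn's lemma
    ([exists_prime_submodule]).  Hence
      a b r M inside K, with a and b non-units, gives a b in (K : M) or r in p,
    and p is prime.  If sqrt(K : m) is contained in p, the two are equal.
    Otherwise some r outside p kills m modulo K.  Write m as a combination of
    vectors with coefficients a_i such that a_i M lies in R m, as a
    multiplication module allows.  For a non-unit b we have b a_i r M inside K,
    so b a_i M lies in K, so b m is in K: all the non-units lie in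
    sqrt(K : m), which is then the maximal ideal of a local ring. *)

Set Implicit Arguments.
Unset Strict Implicit.

(** * Submodules as sets *)

Section Submodules.
Variables (R : comNzRingType) (M : lmodType R).
Implicit Types (N P : set M) (r : R) (m : M).

Lemma submoduleP N : is_submodule N <->
  N 0 /\ forall r x y, N x -> N y -> N (r *: x + y).
Proof.
split=> [[N0 NL]|[N0 NL]].
  split=> [|r x y Nx Ny]; first by move: N0; rewrite inE.
  by have := NL r x y; rewrite !inE; apply.
split=> [|r x y]; first by rewrite inE.
by rewrite !inE; apply: NL.
Qed.

Lemma submodule0 N : is_submodule N -> N 0.
Proof. by case/submoduleP. Qed.

Lemma submoduleZ N r x : is_submodule N -> N x -> N (r *: x).
Proof. by case/submoduleP=> N0 NL Nx; rewrite -[_ *: _]addr0; apply: NL. Qed.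

Lemma submoduleD N x y : is_submodule N -> N x -> N y -> N (x + y).
Proof. by case/submoduleP=> N0 NL Nx Ny; rewrite -[x]scale1r; apply: NL. Qed.

Lemma submoduleB N x y : is_submodule N -> N x -> N y -> N (x - y).
Proof.
by case/submoduleP=> N0 NL Nx Ny; rewrite addrC -scaleN1r; apply: NL.
Qed.

Lemma submodule_sum N (I : Type) (s : seq I) (Q : pred I) (F : I -> M) :
  is_submodule N -> (forall i, Q i -> N (F i)) -> N (\sum_(i <- s | Q i) F i).
Proof.
move=> Nsub NF; apply: big_ind => //; first exact: submodule0.
by move=> x y; apply: submoduleD.
Qed.

Lemma submodule_add N (L : set M) : is_submodule N -> is_submodule L ->
  is_submodule [set x | exists y z, [/\ N y, L z & x = y + z]].
Proof.
move=> Nsub Lsub; apply/submoduleP; split=> [|r x x'].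
  by exists 0, 0; rewrite addr0; split=> //; apply: submodule0.
move=> [y [z [Ny Lz ->]]] [y' [z' [Ny' Lz' ->]]].
exists (r *: y + y'), (r *: z + z'); split.
- by apply: submoduleD => //; apply: submoduleZ.
- by apply: submoduleD => //; apply: submoduleZ.
- by rewrite scalerDr addrACA.
Qed.

Lemma submodule_image_scale r : is_submodule (range (fun m : M => r *: m)).
Proof.
apply/submoduleP; split=> [|a _ _ [x _ <-] [y _ <-]].
  by exists 0 => //; rewrite scaler0.
by exists (a *: x + y) => //; rewrite scalerDr !scalerA mulrC.
Qed.

Lemma submodule_cyclic m : is_submodule (range (fun r : R => r *: m)).
Proof.
apply/submoduleP; split=> [|a _ _ [x _ <-] [y _ <-]].
  by exists 0 => //; rewrite scale0r.
by exists (a * x + y) => //; rewrite scalerDl scalerA.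
Qed.

Lemma submodule_bigcup_chain (F : set (set M)) :
  F !=set0 -> total_on F subset -> (forall X, F X -> is_submodule X) ->
  is_submodule (\bigcup_(X in F) X).
Proof.
move=> [X0 FX0] tot Fsub; apply/submoduleP; split.
  by exists X0 => //; apply: submodule0; apply: Fsub.
move=> r x y [X FX Xx] [Y FY Yy].
have [XY|YX] := tot _ _ FX FY.
  exists Y => //; apply: submoduleD; [exact: Fsub| |done].
  by apply: submoduleZ; [exact: Fsub|exact: XY].
exists X => //; apply: submoduleD; [exact: Fsub| |exact: YX].
by apply: submoduleZ => //; exact: Fsub.
Qed.

End Submodules.

(** * Zorn's lemma above a given set *)

(** [Zorn_bigcup] also requires the empty union to have the property, which
    fails for properties such as being a submodule.  Applying it to the X such
    that the union of X and N has the property turns that requirement into the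
    property of N itself. *)
Lemma Zorn_above T (P : set (set T)) (N : set T) : P N ->
  (forall F, F !=set0 -> F `<=` P -> total_on F subset ->
    P (\bigcup_(X in F) X)) ->
  exists A, [/\ N `<=` A, P A & forall B, A `<=` B -> P B -> B `<=` A].
Proof.
move=> PN Pchain.
have [F FP tot|A [PA maxA]] := @Zorn_bigcup T [set X | P (X `|` N)].
  pose G : set (set T) := N |` [set X `|` N | X in F].
  rewrite /=; have -> : \bigcup_(X in F) X `|` N = \bigcup_(X in G) X.
    apply/seteqP; split=> x.
      move=> [[X FX Xx]|Nx]; last by exists N => //; left.
      by exists (X `|` N); [right; exists X|left].
    move=> [_ [->|[X FX <-]]]; first by right.
    by move=> [Xx|Nx]; [left; exists X|right].
  apply: Pchain; first by exists N; left.
    by move=> _ [->|[X FX <-]] //; exact: FP.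
  move=> _ _ [->|[X FX <-]] [->|[Y FY <-]].
  - by left.
  - by left; apply: subsetUr.
  - by right; apply: subsetUr.
  - by have [XY|YX] := tot _ _ FX FY; [left|right]; apply: setSU.
exists (A `|` N); split=> //.
move=> B AB PB x Bx; apply: contrapT => nAx.
apply: (maxA B); last by rewrite /= setUidl // => y Ny; apply: AB; right.
split; first by move=> y Ay; apply: AB; left.
by move=> BA; apply: nAx; left; apply: BA.
Qed.

(** This is how finite generation enters the Zorn argument: a condition on
    finitely many vectors that holds in the union holds in one member. *)
Lemma chain_finite (T : choiceType) (F : set (set T)) (s : seq T) :
  F !=set0 -> total_on F subset ->
  (forall x, x \in s -> exists2 X, F X & X x) ->
  exists2 X, F X & forall x, x \in s -> X x.
Proof.
move=> [X0 FX0] tot; elim: s => [|a s IH] H; first by exists X0.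
have [|X FX Xs] := IH; first by move=> x xs; apply: H; rewrite inE xs orbT.
have [|Y FY Ya] := H a; first by rewrite inE eqxx.
have [XY|YX] := tot _ _ FX FY.
  by exists Y => // x; rewrite inE => /predU1P[->//|/Xs/XY].
by exists X => // x; rewrite inE => /predU1P[->|/Xs//]; exact: YX.
Qed.

(** * Radicals of submodules and of colon ideals *)

Section Radicals.
Variables (R : comNzRingType) (M : lmodType R).
Implicit Types (N P : set M) (r : R) (m : M).

Lemma finite_generators : finitely_generated M ->
  exists s : seq M, forall P r, is_submodule P ->
    (forall x, x \in s -> P (r *: x)) -> colon_module P r.
Proof.
move=> [n [g Hg]]; exists (codom g) => P r Psub Pg m.
have [c ->] := Hg m; rewrite scaler_sumr; apply: submodule_sum => // i _.
rewrite scalerA mulrC -scalerA; apply: submoduleZ => //.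
exact/Pg/codom_f.
Qed.

(** Let P be maximal among the submodules above N that contain no r^k M; finite
    generation makes this family inductive.  If a x is in P but neither
    a M nor x is, then P + R x contains some r^k M and P + a M some r^l M, and
    r^(k+l) M = r^k (r^l M) is inside P + a r^k M, hence inside
    P + a (P + R x), which is P: contradiction. *)
Lemma exists_prime_submodule N r : finitely_generated M -> is_submodule N ->
  ~ radical (colon_module N) r ->
  exists P, [/\ prime_submodule P, N `<=` P & ~ colon_module P r].
Proof.
move=> /finite_generators[s Hs] Nsub rN.
pose good (X : set M) :=
  is_submodule X /\ forall k, (0 < k)%N -> ~ colon_module X (r ^+ k).
have [||P [NP [Psub rP] maxP]] := @Zorn_above M good N.
- by split=> // k k0 Nrk; apply: rN; exists k.
- move=> F F0 Fgood tot.
  have Fsub X : F X -> is_submodule X by move/Fgood=> [].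
  split=> [|k k0 rk]; first exact: submodule_bigcup_chain.
  have [|X FX Xs] := @chain_finite _ F [seq r ^+ k *: x | x <- s] F0 tot.
    by move=> _ /mapP[x _ ->]; have [X ? ?] := rk x; exists X.
  have [Xsub rX] := Fgood _ FX.
  apply: (rX k) => //; apply: Hs => // x xs; apply: Xs.
  exact: map_f.
have rP1 : ~ colon_module P r by move=> H; apply: (rP 1%N).
exists P; split=> //; split=> //.
  by move=> PT; apply: rP1 => m; rewrite PT.
have grow L : is_submodule L -> ~ (L `<=` P) ->
    exists2 k, (0 < k)%N &
      forall m, exists y z, [/\ P y, L z & r ^+ k *: m = y + z].
  move=> Lsub LP; apply: contrapT => nk; apply: LP.
  pose Q := [set x | exists y z, [/\ P y, L z & x = y + z]].
  have Qgood : good Q.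
    split; first exact: submodule_add.
    by move=> k k0 Hk; apply: nk; exists k.
  have QP : Q `<=` P.
    apply: maxP => // x Px; exists x, 0; rewrite addr0; split=> //.
    exact: submodule0.
  move=> x Lx; apply: QP; exists 0, x; rewrite add0r; split=> //.
  exact: submodule0.
move=> a x Pax; apply: contrapT => /not_orP[aP xP].
have [||k k0 Hk] := grow (range (fun r : R => r *: x)).
- exact: submodule_cyclic.
- by move=> H; apply: xP; apply: H; exists 1 => //; rewrite scale1r.
have [||l l0 Hl] := grow (range (fun m : M => a *: m)).
- exact: submodule_image_scale.
- by move=> H; apply: aP => m; apply: H; exists m.
apply: (rP (k + l)%N); first by rewrite addn_gt0 k0.
move=> m; rewrite exprD -scalerA.
have [y [_ [Py [m' _ <-] ->]]] := Hl m.
have [y' [_ [Py' [c _ <-] E]]] := Hk m'.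
rewrite scalerDr; apply: submoduleD => //; first exact: submoduleZ.
rewrite scalerA mulrC -scalerA E scalerDr scalerA mulrC -scalerA.
by apply: submoduleD => //; apply: submoduleZ.
Qed.

Lemma colon_module_radical N r : finitely_generated M -> is_submodule N ->
  colon_module (module_radical N) r -> radical (colon_module N) r.
Proof.
move=> Mfg Nsub rN; apply: contrapT => /(exists_prime_submodule Mfg Nsub).
by move=> [P [Pp NP]]; apply=> m; apply: (rN m).
Qed.

(** If R m = I M, every a in I satisfies a M <= R m; expand m itself in I M. *)
Lemma mem_multiplication_module m : multiplication_module M ->
  exists n (a : 'I_n -> R) (x : 'I_n -> M),
    (forall i y, exists c, a i *: y = c *: m) /\ m = \sum_(i < n) a i *: x i.
Proof.
move=> /(_ _ (submodule_cyclic m))[I [_ EI]].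
have : range (fun r : R => r *: m) m by exists 1 => //; rewrite scale1r.
rewrite EI => -[n [a [x [Ia Em]]]]; exists n, a, x; split=> // i y.
have : ideal_smul I (a i *: y).
  by exists 1%N, (fun=> a i), (fun=> y); rewrite big_ord1.
by rewrite -EI => -[c _ <-]; exists c.
Qed.

Definition prime_set (q : set R) :=
  ~ q 1 /\ forall x y, q (x * y) -> q x \/ q y.

Lemma prime_set_prod (q : set R) (I : finType) (Q : pred I) (F : I -> R) :
  prime_set q -> (forall i, Q i -> ~ q (F i)) -> ~ q (\prod_(i | Q i) F i).
Proof.
move=> [q1 qM] qF; apply: (big_ind (fun x => ~ q x)) => // x y qx qy.
by case/qM.
Qed.

Lemma radical_expr (I : set R) r k :
  (0 < k)%N -> radical I (r ^+ k) -> radical I r.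
Proof.
move=> k0 [l l0 Ir]; exists (k * l)%N; first by rewrite muln_gt0 k0.
by rewrite exprM.
Qed.

(** The radical is either sqrt(N : M), which is prime, or, when some r
    outside sqrt(N : M) satisfies r m in N, the set of all non-units.  The
    cancellation hypothesis on S removes every occurrence of s. *)
Lemma radical_colon_elt_prime (S : set R) N m :
  finitely_generated M -> multiplication_module M -> mult_closed S ->
  (forall t x, S t -> N (t *: x) -> N x) ->
  S_1_absorbing_primary S N -> ~ N m ->
  prime_set (radical (colon_elt N m)).
Proof.
move=> Mfg Mmult [_ SM] Nsat [Nsub _ [s Ss Nabs]] mN.
have SX k : S (s ^+ k.+1).
  elim: k => [//|k IH]; rewrite exprS; have := SM s (s ^+ k.+1).
  by rewrite !inE; apply.
have unitN r x : is_unit r -> N (r *: x) -> N x.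
  move=> [b rb] Nrx.
  by rewrite -[x]scale1r -rb mulrC -scalerA; apply: submoduleZ.
have sP r : radical (colon_module N) (s * r) -> radical (colon_module N) r.
  move=> [[//|k] _ Hk]; exists k.+1 => // x; apply: (Nsat _ _ (SX k)).
  by rewrite scalerA -exprMn; apply: Hk.
(* The absorbing property freed of s, with m replaced by all of r M. *)
have abs a b r : ~ is_unit a -> ~ is_unit b ->
    colon_module N (a * b * r) ->
    colon_module N (a * b) \/ radical (colon_module N) r.
  move=> aU bU abr.
  have [|nab] := pselect (colon_module N (a * b)); first by left.
  right; apply/sP/colon_module_radical => // x.
  rewrite -scalerA; have [|sab|//] := Nabs a b (r *: x) aU bU.
    by rewrite scalerA.
  case: nab => y; apply: (Nsat _ _ Ss); rewrite scalerA mulrA; exact: sab.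
have p_prime : forall x y, radical (colon_module N) (x * y) ->
    radical (colon_module N) x \/ radical (colon_module N) y.
  move=> x y [k k0 xyN].
  have [xkU|xkU] := pselect (is_unit (x ^+ k)).
    right; exists k => // z; apply: (unitN _ _ xkU).
    by rewrite scalerA -exprMn; apply: xyN.
  (* x^k serves as both non-unit factors, so y may be a unit. *)
  have [|xx|yk] := abs _ _ (y ^+ k) xkU xkU.
  - move=> z; rewrite -mulrA -exprMn -scalerA.
    by apply: submoduleZ => //; apply: xyN.
  - by left; exists (k + k)%N; rewrite ?addn_gt0 ?k0 // exprD.
  - by right; apply: radical_expr k0 yk.
have q1 : ~ radical (colon_elt N m) 1.
  by move=> [k _]; rewrite expr1n /colon_elt /= scale1r.
split=> //.
have [qp|qNp] :=
  pselect (radical (colon_elt N m) `<=` radical (colon_module N)).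
  move=> x y /qp/p_prime[] [k k0 H]; [left|right]; exists k => //; exact: H.
have [r [k k0 rkm] rNp] : exists2 r, radical (colon_elt N m) r
    & ~ radical (colon_module N) r.
  apply: contrapT => H; apply: qNp => r qr; apply: contrapT => pr.
  by apply: H; exists r.
have rkNp : ~ radical (colon_module N) (r ^+ k).
  by move=> /(radical_expr k0).
have [n [a [x [am Em]]]] := mem_multiplication_module m Mmult.
have arN i y : N (a i *: (r ^+ k *: y)).
  rewrite scalerA mulrC -scalerA; have [c ->] := am i y.
  by rewrite scalerA mulrC -scalerA; apply: submoduleZ.
have aU i : ~ is_unit (a i).
  move=> U; apply: rkNp; exists 1%N => // y; exact/(unitN _ _ U)/arN.
have nonunit b : ~ is_unit b -> N (b *: m).
  move=> bU; rewrite Em scaler_sumr; apply: submodule_sum => // i _.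
  rewrite scalerA; have [|H|//] := abs b (a i) (r ^+ k) bU (aU i).
    by move=> y; rewrite -2!scalerA; apply: submoduleZ.
  exact: H.
move=> u v [l l0 uv].
have [uU|uU] := pselect (is_unit u); last first.
  by left; exists 1%N => //; apply: nonunit.
have [vU|vU] := pselect (is_unit v); last first.
  by right; exists 1%N => //; apply: nonunit.
case: mN; case: uU => u' uu'; case: vU => v' vv'.
(* Two units have a unit product, so (u v)^l m in N would give m in N. *)
rewrite -[m]scale1r -(expr1n _ l) -[1](mulr1) -{1}uu' -vv'.
rewrite mulrACA exprMn mulrC -scalerA.
exact: submoduleZ.
Qed.

End Radicals.

(** * Irredundant covers *)

Lemma exists_minimal_cover (T : Type) (I : finType) (N : set T)
  (F : I -> set T) :
  N `<=` \bigcup_(k in [set: I]) F k ->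
  exists A : {set I}, (forall x, N x -> exists2 k, k \in A & F k x) /\
    forall k, k \in A -> exists x, [/\ N x, F k x &
      forall j, j \in A -> j != k -> ~ F j x].
Proof.
move=> cov.
pose P (A : {set I}) := `[< forall x, N x -> exists2 k, k \in A & F k x >].
have [|A /minsetP[/asboolP PA minA]] := @ex_minset _ P.
  exists [set: I]%SET; apply/asboolP => x /cov[k _ Fx].
  by exists k => //; rewrite finset.inE.
exists A; split=> // k kA; apply: contrapT => nx.
have /setP/(_ k) : (A :\ k)%SET = A.
  apply: minA; last exact: subD1set.
  apply/asboolP => x Nx; apply: contrapT => nj.
  have notF j : j \in A -> j != k -> ~ F j x.
    by move=> jA jk Fj; apply: nj; exists j; rewrite // !finset.inE jk.
  have [i iA Fi] := PA _ Nx.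
  have ik : i = k by apply: contrapT => /eqP ik; apply: (notF i).
  by apply: nx; exists x; split=> //; rewrite -ik.
by rewrite !finset.inE eqxx kA.
Qed.

(** Take y in N lying in F k only.  If x lies in all the other members, x + y
    lies in none of them, so in F k, and x = (x + y) - y does too. *)
Lemma mem_minimal_cover (R : comNzRingType) (M : lmodType R) (I : finType)
  (N : set M) (F : I -> set M) (A : {set I}) (k : I) (x : M) :
  is_submodule N -> (forall j, is_submodule (F j)) ->
  (forall x, N x -> exists2 j, j \in A & F j x) ->
  (exists y, [/\ N y, F k y & forall j, j \in A -> j != k -> ~ F j y]) ->
  N x -> (forall j, j \in A -> j != k -> F j x) -> F k x.
Proof.
move=> Nsub Fsub cov [y [Ny Fy nFy]] Nx Fx.
have [j jA Fj] := cov _ (submoduleD Nsub Nx Ny).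
have [jk|jk] := eqVneq j k.
  by subst j; rewrite -[x](addrK y); apply: submoduleB.
case: (nFy j jA jk); rewrite -[y](addKr x) addrC.
by apply: submoduleB => //; apply: Fx.
Qed.

Lemma exists_notin_card (I : finType) (A : {set I}) (B : set I) n :
  (B #<= `I_n)%card -> (n < #|A|)%N -> exists2 k, k \in A & ~ B k.
Proof.
move=> Bn nA; apply: contrapT => H.
have AT : (@enum_val I A) @^-1` B = [set: 'I_#|A|].
  apply/seteqP; split=> // i _; apply: contrapT => nB.
  by apply: H; exists (enum_val i); rewrite // enum_valP.
have inj : {in (@enum_val I A) @^-1` B &, injective (@enum_val I A)}.
  by move=> x y _ _; apply: enum_val_inj.
have := card_ge_preimage inj; rewrite AT => AB.
have := card_le_trans AB Bn; rewrite -(card_le_eql card_II) card_le_II.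
by rewrite leqNgt nA.
Qed.

(** * Avoidance *)

Unset Implicit Arguments.
Set Strict Implicit.

Theorem theorem10 (R : comNzRingType) (M : lmodType R) (S : set R)
  (n : nat) (N : set M) (Nf : 'I_n -> set M)
  (M_fg : finitely_generated M)
  (M_mult : multiplication_module M)
  (S_mult : mult_closed S)
  (N_sub : is_submodule N)
  (Nf_sub : forall k : 'I_n, is_submodule (Nf k))
  (N_cover : N `<=` \bigcup_(k in [set: 'I_n]) Nf k)
  (at_most_two : ([set k : 'I_n | ~ S_1_absorbing_primary S (Nf k)] #<= `I_2)%card)
  (rad_disjoint : forall (k : 'I_n) (m : M), ~ Nf k m ->
     radical (colon_elt (Nf k) m) `&` S = set0)
  (rad_not_sub : forall j k : 'I_n, j <> k ->
     forall (s : R) (m : M), S s -> ~ Nf k m ->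
       ~ (radical (colon_module (Nf j)) `<=`
          colon_ideal (radical (colon_elt (Nf k) m)) s)) :
  exists k : 'I_n, N `<=` Nf k.
Proof.
have [A [covA minA]] := exists_minimal_cover N_cover.
have [k0 k0A _] := covA _ (submodule0 N_sub).
have [A1|] := leqP #|A| 1.
  exists k0 => x /covA[k kA Fx]; rewrite (_ : k0 = k) //.
  exact: (card_le1_eqP A1).
move=> A_gt1.
(* Another member j owns an element of N that no member but j contains. *)
have other k : k \in A -> exists2 m, N m & ~ Nf k m.
  move=> kA; have [j jA jk] : exists2 j, j \in A & j != k.
    have [a [b [aA bA ab]]] := card_gt1P A_gt1.
    have [ak|] := eqVneq a k; last by exists a.
    by exists b => //; rewrite -ak eq_sym.
  have [x [Nx _ nF]] := minA _ jA.
  by exists x => //; apply: nF; rewrite // eq_sym.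
(* With two members F a and F b, an element of N in F a only would lie in F b
   by [mem_minimal_cover]. *)
have A_gt2 : (2 < #|A|)%N.
  rewrite ltn_neqAle A_gt1 andbT; apply/eqP => /esym/eqP/cards2P[a [b [ab AE]]].
  have aA : a \in A by rewrite AE !finset.inE eqxx.
  have bA : b \in A by rewrite AE !finset.inE eqxx orbT.
  have [x [Nx Fx nFx]] := minA _ aA.
  apply: (nFx b) => //; first by rewrite eq_sym.
  apply: (mem_minimal_cover N_sub Nf_sub covA (minA _ bA) Nx) => j.
  by rewrite AE finset.in_set2 => /orP[/eqP->|/eqP-> /eqP].
have [k kA /contrapT Nk_abs] := exists_notin_card at_most_two A_gt2.
have [m Nm nNkm] := other _ kA.
have sat t x : S t -> Nf k (t *: x) -> Nf k x.
  move=> St Ntx; apply: contrapT => nNx.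
  have : (radical (colon_elt (Nf k) x) `&` S) t by split=> //; exists 1%N.
  by rewrite rad_disjoint.
have prime_q := radical_colon_elt_prime M_fg M_mult S_mult sat Nk_abs nNkm.
have S1 : S 1 by case: S_mult; rewrite inE.
(* Taking s = 1; the powers put into (Nf j : M) itself what is given only in
   its radical. *)
have wit j : exists r, j != k ->
    colon_module (Nf j) r /\ ~ radical (colon_elt (Nf k) m) r.
  have [->|jk] := eqVneq j k; first by exists 0.
  apply: contrapT => nr; apply: (rad_not_sub j k (elimN eqP jk) 1 m S1 nNkm).
  move=> r [e e0 re]; rewrite /colon_ideal /= mulr1.
  apply: contrapT => nqr; apply: nr; exists (r ^+ e) => _; split=> //.
  by move=> /(radical_expr e0).
pose r j := sval (cid (wit j)).
have rP j : j != k ->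
    colon_module (Nf j) (r j) /\ ~ radical (colon_elt (Nf k) m) (r j).
  by rewrite /r; case: cid.
have : ~ radical (colon_elt (Nf k) m) (\prod_(j | j != k) r j).
  by apply: prime_set_prod => // j /rP[].
case; exists 1%N => //.
apply: (mem_minimal_cover N_sub Nf_sub covA (minA _ kA)).
  exact: submoduleZ.
move=> j jA jk; rewrite (bigD1 j) //= mulrC -scalerA.
apply: submoduleZ => //; exact: (rP j jk).1.
Qed.
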